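(* Let $\mathcal{M}$ be a matroid. Then its independence polytope $\mathcal{P}(\mathcal{M})$ has the clique-face property, i.e. every clique of the $1$-skeleton $\mathrm{sk}(\mathcal{P}(\mathcal{M}))$ is the vertex set of a face of $\mathcal{P}(\mathcal{M})$.
   Context: A matroid $\mathcal{M}=(E,\mathcal{I})$ consists of a finite set $E=\{e_1,\dots,e_n\}$ and $\mathcal{I}\subseteq 2^E$ (the independent sets) such that $\emptyset\in\mathcal{I}$; subsets of members of $\mathcal{I}$ are in $\mathcal{I}$; and if $I_1,I_2\in\mathcal{I}$ with $|I_1|<|I_2|$ then $I_1\cup\{x\}\in\mathcal{I}$ for some $x\in I_2\setminus I_1$. For $I\subset E$ let $\rho(I)=\sum_{e_i\in I}\mathbf{e}_i\in\{0,1\}^n$, with $\mathbf{e}_i$ the unit coordinate vectors of $\mathbb{R}^n$. The independence polytope is $\mathcal{P}(\mathcal{M})=\mathrm{conv}\{\rho(I):I\in\mathcal{I}\}$. The $1$-skeleton $\mathrm{sk}(P)$ of a polytope $P$ is the simple graph on the vertices of $P$ with $v\ne w$ adjacent iff $\mathrm{conv}(\{v,w\})$ is an edge of $P$. A clique is the vertex set of a complete subgraph. $P$ itself is regarded as a face of $P$. *)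

(* Defs.v *)
From mathcomp Require Import all_boot all_order all_algebra.
From mathcomp Require Import boolp classical_sets reals.

Set Implicit Arguments.
Unset Strict Implicit.
Unset Printing Implicit Defensive.

Import Order.TTheory GRing.Theory Num.Theory.
Local Open Scope classical_set_scope.
Local Open Scope ring_scope.

(* The ground set is the whole type E. *)
Record matroid (E : finType) := Matroid {
  indep : {set {set E}};
  indep0 : finset.set0 \in indep;
  indepS : forall I J : {set E}, J \subset I -> I \in indep -> J \in indep;
  indep_exchange : forall I1 I2 : {set E},
    I1 \in indep -> I2 \in indep -> (#|I1| < #|I2|)%N ->
    exists2 x, x \in I2 :\: I1 & x |: I1 \in indep
}.

Section Polytopes.
Context {R : realType} {n : nat}.
Implicit Types (A P F C : set 'rV[R]_n) (c v w x : 'rV[R]_n).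

Definition convex_hull A : set 'rV[R]_n :=
  [set x | exists (m : nat) (p : 'I_m -> 'rV[R]_n) (a : 'I_m -> R),
     [/\ forall i, A (p i), forall i, 0 <= a i, \sum_i a i = 1
       & x = \sum_i a i *: p i]].

Definition dotp c x : R := \sum_i c 0 i * x 0 i.

(* Faces are cut out by valid linear inequalities c.x <= b. Taking c = 0, the
   bounds b = 0 and b = 1 give P itself and the empty face, respectively. *)
Definition is_face P F : Prop :=
  exists (c : 'rV[R]_n) (b : R),
    (forall x, P x -> dotp c x <= b) /\ F = [set x | P x /\ dotp c x = b].

(* F has affine dimension d: the points x0, x0 + B_0, ..., x0 + B_(d-1) of F are
   affinely independent and their affine span contains F. *)
Definition has_dim F (d : nat) : Prop :=
  exists (x0 : 'rV[R]_n) (B : d.-tuple 'rV[R]_n),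
    [/\ F x0, forall i, F (x0 + tnth B i), free B
      & forall x, F x -> x - x0 \in <<B>>%VS].

Definition is_edge P F : Prop := is_face P F /\ has_dim F 1.

Definition vertices P : set 'rV[R]_n := [set v | is_face P [set v]].

Definition sk_adj P v w : Prop :=
  [/\ vertices P v, vertices P w, v <> w & is_edge P (convex_hull [set v; w])].

Definition sk_clique P C : Prop :=
  C `<=` vertices P /\
  forall v w, C v -> C w -> v <> w -> sk_adj P v w.

Definition clique_face_property P : Prop :=
  forall C, sk_clique P C -> exists2 F, is_face P F & vertices F = C.

End Polytopes.

(* R^n with n = #|E|; the coordinate of e is its rank in the enumeration of E. *)
Definition rho (R : realType) (E : finType) (I : {set E}) : 'rV[R]_#|E| :=
  \sum_(e in I) delta_mx 0 (enum_rank e).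

Definition independence_polytope (R : realType) (E : finType) (M : matroid E) :
    set 'rV[R]_#|E| :=
  convex_hull [set rho R I | I in [set I | I \in indep M]].

Arguments independence_polytope R {E} M.

(* Main.v *)
Require Import Defs.
From mathcomp Require Import all_boot all_order all_algebra.
From mathcomp Require Import boolp classical_sets reals.
From mathcomp Require Import fintype finset.

(** Write [I] for the vertex [rho I].  The proof goes through a purely
    combinatorial picture of the 1-skeleton.

    If [I] and [J] span an edge, then some weight on the ground set is maximized
    over the independent sets by [I] and [J] only.  Moving one element from [J]
    to [I], or swapping two elements, keeps the total weight of the two sets; the
    exchange axiom then forces [I] and [J] to be neighbours in the sense of
    [adjacent]: each has at most one element outside the other, and if they are
    incomparable their union is dependent ([edge_adjacent]).

    A nonempty family of pairwise [adjacent] independent sets has one of three shapes: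
    - it has a least member [A], as it does when two of its members are
      comparable, and the others are of the form [z |: A];
    - it is a star, all of its members being of the form [z |: A] for some [A]
      outside the family;
    - it is a costar, all of its members being of the form [U :\ z].
    In the first case the family consists of all the independent sets between its
    intersection and its union; in the other two, of those that moreover have
    the largest possible size.  Each of these conditions (containing [N], being
    contained in [U], having maximal size in [U]) says that some weight is
    maximal, and adding the weights imposes them simultaneously
    ([exposed_clique]).  The sum of the weights cuts out the required face. *)

Set Implicit Arguments.
Unset Strict Implicit.
Unset Printing Implicit Defensive.

Import Order.TTheory GRing.Theory Num.Theory.
Local Open Scope ring_scope.

(** * Families of independent sets exposed by a weight *)

Section Exposed.
Context {R : realType} {E : finType} (M : matroid E).
Implicit Types (I J K L A N U X : {set E}) (f : E -> R) (b : R).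

Definition weight f K : R := \sum_(e in K) f e.

Definition exposes f b (Q : pred {set E}) : Prop :=
  forall K, K \in indep M -> weight f K <= b ?= iff Q K.

Definition exposed (Q : pred {set E}) : Prop := exists f b, exposes f b Q.

Lemma weightU1 f x I : x \notin I -> weight f (x |: I) = f x + weight f I.
Proof. by move=> xI; rewrite /weight big_setU1. Qed.

Lemma weightD1 f x I : x \in I -> weight f I = f x + weight f (I :\ x).
Proof. by move=> xI; rewrite /weight (big_setD1 x). Qed.

Lemma weight_indicator X K :
  weight (fun e => (e \in X)%:R) K = #|K :&: X|%:R.
Proof.
rewrite /weight -sum1_card natr_sum big_mkcond [RHS]big_mkcond /=.
by apply: eq_bigr => e _; rewrite inE; case: (e \in K); case: (e \in X).
Qed.

Lemma eq_exposed Q Q' :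
  {in indep M, Q =1 Q'} -> exposed Q -> exposed Q'.
Proof.
by move=> QQ' [f [b fb]]; exists f, b => K KM; rewrite -QQ' //; apply: fb.
Qed.

Lemma exposedI Q Q' : exposed Q -> exposed Q' -> exposed (predI Q Q').
Proof.
move=> [f [b fb]] [f' [b' fb']]; exists (fun e => f e + f' e), (b + b') => K KM.
rewrite /weight big_split; exact: leifD (fb K KM) (fb' K KM).
Qed.

Lemma exposed0 : exposed pred0.
Proof.
exists (fun=> 0), 1 => K _; rewrite /weight big1 //.
by split; rewrite ?ler01 // eq_sym oner_eq0.
Qed.

Lemma exposed_rank X k :
  {in indep M, forall K, (#|K :&: X| <= k)%N} ->
  exposed (fun K => #|K :&: X| == k).
Proof.
move=> rX; exists (fun e => (e \in X)%:R), k%:R => K KM.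
by rewrite weight_indicator; split; rewrite ?ler_nat ?rX // eqr_nat.
Qed.

Lemma exposed_sup N : exposed (fun K => N \subset K).
Proof.
apply: (@eq_exposed (fun K => #|K :&: N| == #|N|)).
  move=> K _; rewrite (subset_leqif_cards (subsetIr K N)).
  by apply/eqP/idP => [/setIidPr|/setIidPr].
by apply: exposed_rank => K _; rewrite subset_leq_card // subsetIr.
Qed.

Lemma exposed_sub U : exposed (fun K => K \subset U).
Proof.
exists (fun e => - (e \in ~: U)%:R), 0 => K _.
have -> : weight (fun e => - (e \in ~: U)%:R) K = - #|K :&: ~: U|%:R.
  by rewrite -weight_indicator /weight sumrN.
split; first by rewrite oppr_le0.
by rewrite oppr_eq0 pnatr_eq0 cards_eq0 -setDE setD_eq0.
Qed.

Lemma exposed_interval N U : exposed (fun K => (N \subset K) && (K \subset U)).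
Proof. exact: exposedI (exposed_sup N) (exposed_sub U). Qed.

(** In the faces used below, [k] is the rank of [U]. *)
Lemma exposed_interval_rank N U k :
  {in indep M, forall K, K \subset U -> (#|K| <= k)%N} ->
  exposed (fun K => [&& N \subset K, K \subset U & #|K| == k]).
Proof.
move=> rU.
have rU' : {in indep M, forall K, (#|K :&: U| <= k)%N}.
  by move=> K KM; apply: rU; rewrite ?subsetIr // (indepS (subsetIl K U)).
apply: eq_exposed (exposedI (exposed_interval N U) (exposed_rank rU')).
move=> K _ /=; rewrite -andbA; congr andb.
by case: (boolP (K \subset U)) => // /setIidPl ->.
Qed.

Lemma exposed1 I : exposed (pred1 I).
Proof.
apply: eq_exposed (exposed_interval I I) => K _ /=.
by rewrite eqEsubset andbC.
Qed.

(** * Edges *)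

(** The adjacency relation of the 1-skeleton in terms of the matroid, except that
    a set is also adjacent to itself. *)
Definition adjacent I J : bool :=
  [&& #|I :\: J| <= 1, #|J :\: I| <= 1
    & [|| I \subset J, J \subset I | I :|: J \notin indep M]]%N.

Lemma adjacent_sym I J : adjacent I J = adjacent J I.
Proof. by rewrite /adjacent setUC andbCA orbCA. Qed.

(** Moving [x] from [J] to [I] preserves the total weight [b + b].  As neither of
    the new sets exceeds [b], both attain it, and [x |: I] is a maximizer other
    than [I]. *)
Lemma edge_augment f b I J x :
  exposes f b (pred2 I J) -> I \in indep M -> J \in indep M ->
  x \in J :\: I -> x |: I \in indep M -> x |: I = J.
Proof.
move=> fb IM JM /setDP [xJ xI] xIM.
have JxM : J :\ x \in indep M by apply: indepS JM; rewrite subD1set.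
have [_ /eqP] := fb _ IM; rewrite /= eqxx => /eqP/eqP wI.
have [_ /eqP] := fb _ JM; rewrite /= eqxx orbT => /eqP/eqP wJ.
have [lex ex] := fb _ xIM; have [ley _] := fb _ JxM.
have fx : 0 <= f x by move: ley; rewrite -wJ (weightD1 f xJ) lerDr.
have : weight f (x |: I) == b by rewrite eq_le lex /= (weightU1 f xI) wI lerDr.
rewrite ex /= => /orP [/eqP eI|/eqP //].
by case/negP: xI; rewrite -eI setU11.
Qed.

(** An element [x] of [J :\: I] can be replaced by some [y] of [I :\: J]; as [J]
    is a maximizer, [y] is at most as heavy as [x], and if it is as heavy the
    result is again a maximizer. *)
Lemma edge_swap f b I J x :
  exposes f b (pred2 I J) -> I \in indep M -> J \in indep M ->
  #|I| = #|J| -> x \in J :\: I ->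
  exists y, [/\ y \in I :\: J, f y <= f x & f y = f x -> I = y |: (J :\ x)].
Proof.
move=> fb IM JM cIJ /setDP [xJ xI].
have JxM : J :\ x \in indep M by apply: indepS JM; rewrite subD1set.
have [|y] := indep_exchange JxM IM.
  by rewrite cIJ (cardsD1 x J) xJ.
case/setDP => yI; rewrite !inE negb_and negbK => yJ yM.
have nyx : y != x by apply: contraNneq xI => <-.
rewrite (negPf nyx) /= in yJ.
have yJx : y \notin J :\ x by rewrite !inE negb_and yJ orbT.
have [_ /eqP] := fb _ JM; rewrite /= eqxx orbT => /eqP/eqP wJ.
have [ley ey] := fb _ yM.
exists y; split; first by rewrite inE yI yJ.
  by move: ley; rewrite -wJ (weightU1 f yJx) (weightD1 f xJ) lerD2r.
move=> fyx; move: ey.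
rewrite (weightU1 f yJx) fyx -(weightD1 f xJ) wJ eqxx /= => /esym.
case/orP => [/eqP-> //|/eqP eJ].
by case/negP: yJ; rewrite -eJ setU11.
Qed.

(** For sets of different sizes the exchange axiom allows [edge_augment], which
    makes the smaller set the larger one minus an element.  For sets of equal
    size, no augmentation of [I] by an element of [J] is independent, since it
    would have to equal [J]; this is why [I :|: J] is dependent. *)
Lemma edge_adjacent f b I J :
  exposes f b (pred2 I J) -> I \in indep M -> J \in indep M -> I != J ->
  adjacent I J.
Proof.
wlog leIJ : I J / (#|I| <= #|J|)%N => [hw fb IM JM nIJ|].
  have [/hw|/ltnW leJI] := leqP #|I| #|J|; first exact.
  rewrite adjacent_sym; apply: hw => //; last by rewrite eq_sym.
  by move=> K KM; have := fb K KM; rewrite /= orbC.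
move=> fb IM JM nIJ.
have fb' : exposes f b (pred2 J I).
  by move=> K KM; have := fb K KM; rewrite /= orbC.
move: leIJ; rewrite leq_eqVlt => /orP [/eqP cIJ|ltIJ]; last first.
  have [x xJI xIM] := indep_exchange IM JM ltIJ.
  have eJ := edge_augment fb IM JM xJI xIM.
  have sIJ : I \subset J by rewrite -eJ subsetUr.
  rewrite /adjacent sIJ /= andbT; move: (sIJ); rewrite -setD_eq0 => /eqP ->.
  rewrite cards0 /= -(cards1 x) subset_leq_card // -eJ.
  by rewrite subDset setUC.
have [x0 x0JI] : exists x, x \in J :\: I.
  apply/set0Pn; rewrite setD_eq0; apply: contra nIJ => sJI.
  by rewrite eq_sym eqEcard sJI cIJ leqnn.
(* Swapping back and forth from a lightest [x] shows that all the weights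
   involved are equal. *)
case: (arg_minP f x0JI) => x xJI xmin.
have /setDP [xJ xI] := xJI.
have [y [yIJ leyx eyx]] := edge_swap fb IM JM cIJ xJI.
have [x' [x'JI lex'y _]] := edge_swap fb' JM IM (esym cIJ) yIJ.
have eI : I = y |: (J :\ x).
  by apply: eyx; apply/eqP; rewrite eq_le leyx (le_trans (xmin _ x'JI)).
apply/and3P; split.
- rewrite -(cards1 y) subset_leq_card // eI.
  apply/subsetP => z; rewrite !inE => /andP[/negPf zJ].
  by rewrite zJ andbF orbF.
- rewrite -(cards1 x) subset_leq_card // eI.
  apply/subsetP => z; rewrite !inE => /andP[].
  by rewrite !negb_or negb_and negbK => /andP[_ /orP[//|/negPf->]].
apply/orP; right; apply/orP; right; apply/negP => IJM.
have xIM : x |: I \in indep M.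
  apply: indepS IJM; apply/subsetP => z; rewrite !inE => /orP[/eqP->|->//].
  by rewrite xJ orbT.
have := edge_augment fb IM JM xJI xIM.
move/(congr1 (fun K : {set E} => #|K|)); rewrite cardsU1 xI cIJ.
by move/eqP; rewrite -[X in _ == X]add0n eqn_add2r.
Qed.

(** * Cliques *)

Lemma adjacent_diff I J x y :
  adjacent I J -> x \in I -> x \notin J -> y \in I -> y \notin J -> x = y.
Proof.
case/and3P => /card_le1_eqP IJ _ _ xI xJ yI yJ.
by apply: IJ; rewrite inE ?xJ ?yJ.
Qed.

Lemma adjacent_indepU I J :
  adjacent I J -> I :|: J \in indep M -> (I \subset J) || (J \subset I).
Proof. by case/and3P => _ _ /or3P [-> //|->|/negP //]; rewrite orbT. Qed.

Lemma eq_setU1 A K z :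
  A \subset K -> #|K| = #|A|.+1 -> z \in K -> z \notin A -> K = z |: A.
Proof.
move=> AK cK zK zA; apply/esym/eqP; rewrite eqEcard subUset sub1set zK AK /=.
by rewrite cardsU1 zA cK.
Qed.

(** Here the clique consists of [A] and of sets [z |: A]; two different [z] cannot
    both belong to an independent set, since the union of the corresponding
    members of the clique is dependent. *)
Lemma exposed_min (C : {set {set E}}) A :
  C \subset indep M -> {in C &, forall I J, adjacent I J} ->
  A \in C -> {in C, forall K, A \subset K} -> exposed (mem C).
Proof.
move=> CM adjC AC minA.
apply: eq_exposed (exposed_interval A (\bigcup_(L in C) L)) => K KM.
apply/idP/idP => [/andP[AK KU]|KC]; last by rewrite minA // bigcup_sup.
have addA z : z \in K -> z \notin A -> z |: A \in C.
  move=> /(subsetP KU) /bigcupP [L LC zL] zA.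
  rewrite (_ : z |: A = L) //; apply/eqP; rewrite eqEsubset subUset sub1set zL.
  rewrite minA //=; apply/subsetP => e eL; rewrite !inE.
  have [_|eA] := boolP (e \in A); first by rewrite orbT.
  by rewrite (adjacent_diff (adjC _ _ LC AC) eL eA zL zA) eqxx.
have [KA|/subsetPn [z zK zA]] := boolP (K \subset A).
  by rewrite (_ : K = A) //; apply/eqP; rewrite eqEsubset KA.
suff -> : K = z |: A by exact: addA.
apply/eqP; rewrite eqEsubset subUset sub1set zK AK !andbT; apply/subsetP => w wK.
rewrite !inE; apply/norP => -[wz wA].
have zwM : (z |: A) :|: (w |: A) \in indep M.
  by apply: indepS KM; rewrite !subUset !sub1set zK wK AK.
have /orP [] := adjacent_indepU (adjC _ _ (addA _ zK zA) (addA _ wK wA)) zwM;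
  move/subsetP.
  by move=> /(_ z (setU11 _ _)); rewrite !inE eq_sym (negPf wz) (negPf zA).
by move=> /(_ w (setU11 _ _)); rewrite !inE (negPf wz) (negPf wA).
Qed.

(** All members of a star have the size of the rank of their union: an element
    that augments some member [I] would lie in another member, and [I] would
    have an independent union with it. *)
Lemma exposed_star (C : {set {set E}}) A :
  C \subset indep M -> C != finset.set0 ->
  {in C, forall K, A \subset K /\ #|K| = #|A|.+1} ->
  {in C &, forall K L, K != L -> K :|: L \notin indep M} -> exposed (mem C).
Proof.
move=> CM /set0Pn [I IC] starC depC; have [AI cI] := starC _ IC.
have rU : {in indep M, forall K, K \subset \bigcup_(L in C) L ->
                         (#|K| <= #|A|.+1)%N}.
  move=> K KM KU; rewrite leqNgt -cI; apply/negP => ltIK.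
  have [z /setDP [zK zI] zIM] := indep_exchange (subsetP CM _ IC) KM ltIK.
  have /bigcupP [L LC zL] := subsetP KU _ zK.
  have zA : z \notin A by apply: contra zI => /(subsetP AI).
  have [AL cL] := starC _ LC.
  have nIL : I != L by apply: contraNneq zI => ->.
  case/negP: (depC _ _ IC LC nIL); apply: indepS zIM.
  rewrite subUset subsetUr (eq_setU1 AL cL zL zA) subUset sub1set setU11 /=.
  exact: subset_trans AI (subsetUr _ _).
apply: eq_exposed (exposed_interval_rank A rU) => K KM.
apply/idP/idP => [/and3P[AK KU /eqP cK]|KC]; last first.
  by have [-> ->] := starC _ KC; rewrite bigcup_sup /=.
have /subsetPn [z zK zA] : ~~ (K \subset A).
  by apply/negP => /subset_leq_card; rewrite cK ltnn.
have /bigcupP [L LC zL] := subsetP KU _ zK; have [AL cL] := starC _ LC.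
by rewrite (eq_setU1 AK cK zK zA) -(eq_setU1 AL cL zL zA).
Qed.

(** Since [U] is dependent, its rank is at most [#|U|.-1], the size of the members.
    The intersection of the members tells which elements may be removed. *)
Lemma exposed_costar (C : {set {set E}}) U :
  U \notin indep M ->
  {in C, forall K, K \subset U /\ #|U| = #|K|.+1} -> exposed (mem C).
Proof.
move=> UM costarC.
have rU : {in indep M, forall K, K \subset U -> (#|K| <= #|U|.-1)%N}.
  move=> K KM KU; have /proper_card : K \proper U.
    by rewrite properEneq KU andbT; apply: contraNneq UM => <-.
  by case: #|U|.
apply: eq_exposed (exposed_interval_rank (\bigcap_(L in C) L) rU) => K KM.
apply/idP/idP => [/and3P[NK KU /eqP cK]|KC]; last first.
  by have [-> ->] := costarC _ KC; rewrite bigcap_inf //=.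
have /subsetPn [z zU zK] : ~~ (U \subset K).
  apply: contra UM => UK; rewrite (_ : U = K) //.
  by apply/eqP; rewrite eqEsubset UK.
have cU : #|U| = #|K|.+1 by rewrite cK prednK // card_gt0; apply/set0Pn; exists z.
have [L LC zL] : exists2 L, L \in C & z \notin L.
  apply/exists_inP; rewrite -negb_forall_in; apply: contra zK => /forall_inP zC.
  by apply/(subsetP NK)/bigcapP.
have [LU cL] := costarC _ LC.
rewrite (_ : K = L) //; rewrite -(setU1K zK) -(setU1K zL).
by rewrite -(eq_setU1 KU cU zU zK) -(eq_setU1 LU cL zU zL).
Qed.

(** If [K] missed an element of [I], then it would be [I] with that element
    replaced by one of [J :\: I], so that [I :|: K] would lie in [J] although [I]
    and [K] are incomparable. *)
Lemma clique_min (C : {set {set E}}) I J :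
  C \subset indep M -> {in C &, forall I J, adjacent I J} ->
  I \in C -> J \in C -> I \proper J -> {in C, forall K, I \subset K}.
Proof.
move=> CM adjC IC JC /properP [IJ [x xJ xI]] K KC.
apply/negPn/negP => /subsetPn [a aI aK].
have xK : x \in K.
  apply/negPn/negP => xK; case/negP: xI.
  by rewrite (adjacent_diff (adjC _ _ JC KC) xJ xK (subsetP IJ _ aI) aK).
have IKM : I :|: K \in indep M.
  apply: indepS (subsetP CM _ JC); rewrite subUset IJ.
  apply/subsetP => e eK; have [/(subsetP IJ)//|eI] := boolP (e \in I).
  by rewrite (adjacent_diff (adjC _ _ KC IC) eK eI xK xI).
have /orP [] := adjacent_indepU (adjC _ _ IC KC) IKM; move/subsetP.
  by move/(_ _ aI); apply/negP.
by move/(_ _ xK); apply/negP.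
Qed.

(** With no least member, the members are pairwise incomparable.  For two of them,
    [I] and [J], either all members contain [I :&: J], which makes a star, or
    a member [K0] that misses an element of [I :&: J] contains [I :\: J] and
    [J :\: I], and this confines all members to [I :|: J], which makes a costar. *)
Lemma exposed_clique (C : {set {set E}}) :
  C \subset indep M -> {in C &, forall I J, adjacent I J} -> exposed (mem C).
Proof.
move=> CM adjC.
have [->|/set0Pn [I IC]] := eqVneq C finset.set0.
  by apply: eq_exposed exposed0 => K _; rewrite /= inE.
have [/exists_inP [A AC /forall_inP minA]|/exists_inPn noMin] :=
  boolP [exists A in C, [forall K in C, A \subset K]].
  exact: exposed_min adjC AC minA.
have antiC : {in C &, forall K L, K \subset L -> K = L}.
  move=> K L KC LC KL; apply/eqP/negPn/negP => nKL.
  case/negP: (noMin K KC); apply/forall_inP.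
  by apply: (clique_min CM adjC KC LC); rewrite properEneq nKL.
have depC : {in C &, forall K L, K != L -> K :|: L \notin indep M}.
  move=> K L KC LC; apply: contra => /(adjacent_indepU (adjC _ _ KC LC)).
  by case/orP => [/antiC->|/antiC->].
have diffC : {in C &, forall K L, K != L -> #|K :\: L| = 1%N}.
  move=> K L KC LC nKL; apply/eqP; rewrite eqn_leq card_gt0.
  have /and3P [-> _ _] := adjC _ _ KC LC.
  by rewrite setD_eq0; apply: contra nKL => /antiC->.
have cardC : {in C &, forall K L, #|K| = #|L|}.
  move=> K L KC LC; have [->//|nKL] := eqVneq K L.
  by rewrite -(cardsID L K) -(cardsID K L) setIC !diffC // eq_sym.
have /forall_inPn [J JC /subsetPn [x xI xJ]] := noMin I IC.
have nIJ : I != J by apply: contraNneq xJ => <-.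
have nJI : J != I by rewrite eq_sym.
have /subsetPn [y yJ yI] : ~~ (J \subset I) by apply: contra nJI => /antiC->.
have [/forall_inP starC|/forall_inPn [K0 K0C /subsetPn [a]]] :=
  boolP [forall K in C, I :&: J \subset K].
  apply: (@exposed_star C (I :&: J)) depC => //; first by apply/set0Pn; exists I.
  by move=> K KC; rewrite starC // (cardC K I) // -(cardsID J I) diffC // addn1.
rewrite inE => /andP [aI aJ] aK.
have xK0 : x \in K0.
  apply/negPn/negP => xK0; case/negP: xJ.
  by rewrite (adjacent_diff (adjC _ _ IC K0C) xI xK0 aI aK).
have yK0 : y \in K0.
  apply/negPn/negP => yK0; case/negP: yI.
  by rewrite (adjacent_diff (adjC _ _ JC K0C) yJ yK0 aJ aK).
apply: (@exposed_costar C (I :|: J)); first exact: depC.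
move=> L LC; split; last first.
  by rewrite (cardC L I) // -(cardsID I (I :|: J))
    setUK setDUl setDv set0U diffC ?addn1.
apply/subsetP => z zL; rewrite inE; apply/norP => -[zI zJ].
have yL : y \notin L.
  apply/negP => yL; case/negP: zJ.
  by rewrite (adjacent_diff (adjC _ _ LC IC) zL zI yL yI).
have xL : x \notin L.
  apply/negP => xL; case/negP: zI.
  by rewrite (adjacent_diff (adjC _ _ LC JC) zL zJ xL xJ).
by case/negP: yI; rewrite (adjacent_diff (adjC _ _ K0C LC) yK0 yL xK0 xL).
Qed.

End Exposed.

(** * Vertices of faces of a convex hull *)

Section Hull.
Context {R : realType} {n : nat}.
Implicit Types (A P F : set 'rV[R]_n) (c v x : 'rV[R]_n).

Lemma dotp_sum c m (a : 'I_m -> R) (p : 'I_m -> 'rV[R]_n) :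
  dotp c (\sum_i a i *: p i) = \sum_i a i * dotp c (p i).
Proof.
rewrite /dotp; under eq_bigr => j _ do rewrite summxE big_distrr /=.
rewrite exchange_big /=; apply: eq_bigr => i _.
by rewrite big_distrr /=; apply: eq_bigr => j _; rewrite mxE mulrCA.
Qed.

Lemma sub_convex_hull A x : A x -> convex_hull A x.
Proof.
move=> Ax; exists 1, (fun=> x), (fun=> 1).
by split=> //; rewrite ?ler01 // big_ord_recl big_ord0 ?scale1r addr0.
Qed.

Lemma convex_hull_mono A A' x :
  (forall y, A y -> A' y) -> convex_hull A x -> convex_hull A' x.
Proof.
by move=> AA' [m [p [a [Ap a0 a1 ->]]]]; exists m, p, a; split=> // i; apply: AA'.
Qed.

Lemma dotp_hull_le A c b x :
  (forall y, A y -> dotp c y <= b) -> convex_hull A x -> dotp c x <= b.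
Proof.
move=> Ac [m [p [a [Ap a0 a1 ->]]]].
rewrite dotp_sum -[b]mul1r -a1 big_distrl /=.
by apply: ler_sum => i _; rewrite ler_wpM2l // Ac.
Qed.

Lemma wmean_max m (a t : 'I_m -> R) b :
  (forall i, 0 <= a i) -> \sum_i a i = 1 -> (forall i, a i != 0 -> t i <= b) ->
  \sum_i a i * t i = b -> forall i, a i != 0 -> t i = b.
Proof.
move=> a0 a1 tb sb i ai.
have ge0 j : 0 <= a j * (b - t j).
  have [->|aj] := eqVneq (a j) 0; first by rewrite mul0r.
  by rewrite mulr_ge0 // subr_ge0 tb.
have /eqP : \sum_j a j * (b - t j) = 0.
  under eq_bigr => j _ do rewrite mulrBr.
  by rewrite sumrB sb -big_distrl /= a1 mul1r subrr.
rewrite psumr_eq0 // => /allP /(_ i (mem_index_enum i)).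
by rewrite mulf_eq0 (negPf ai) /= subr_eq0 => /eqP.
Qed.

Lemma verticesP P v :
  vertices P v <-> exists c b,
    [/\ P v, dotp c v = b, forall x, P x -> dotp c x <= b
      & forall x, P x -> dotp c x = b -> x = v].
Proof.
split=> [[c [b [cb vE]]]|[c [b [Pv cv cb cu]]]]; exists c, b.
  have [Pv cv] : P v /\ dotp c v = b.
    by rewrite -[_ /\ _]/([set x | P x /\ dotp c x = b]%classic v) -vE.
  by split=> // x Px cx; suff : [set v]%classic x by []; rewrite vE.
split=> //; apply/funext => x; apply/propext.
by split=> [->//|[Px cx]]; apply: cu.
Qed.

(** Writing a vertex of the face as a convex combination of points of [A], those
    with a nonzero coefficient lie on the face, where they maximize a functional
    that the vertex alone maximizes. *)
Lemma vertices_face_hull A F v :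
  is_face (convex_hull A) F -> vertices F v -> A v.
Proof.
move=> [c [b [cb ->]]] /verticesP [d [b' [[vP cv] dv db' du]]].
have [m [p [a [Ap a0 a1 ve]]]] := vP.
have pc i : a i != 0 -> dotp c (p i) = b.
  apply: (@wmean_max _ a (fun i => dotp c (p i))) => //.
    by move=> j _; apply/cb/sub_convex_hull.
  by rewrite -dotp_sum -ve.
have pd i : a i != 0 -> dotp d (p i) = b'.
  apply: (@wmean_max _ a (fun i => dotp d (p i))) => //.
    by move=> j aj; apply: db'; split; [exact: sub_convex_hull|exact: pc].
  by rewrite -dotp_sum -ve.
have [i ai] : exists i, a i != 0.
  apply/existsP; rewrite -negb_forall; apply/negP => /forallP az.
  move/eqP: a1; rewrite big1 ?(eq_sym 0) ?oner_eq0 // => i _; exact/eqP/az.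
suff <- : p i = v by [].
by apply: du; [split; [exact: sub_convex_hull|exact: pc]|exact: pd].
Qed.

Lemma is_face_self P : is_face P P.
Proof.
have dot0 x : dotp 0 x = 0 :> R by rewrite /dotp big1 // => i _; rewrite mxE mul0r.
exists 0, 0; split=> [x _|]; first by rewrite dot0.
by apply/funext => x; apply/propext; split=> [Px|[]//]; rewrite /= dot0.
Qed.

Lemma vertices_hull A v : vertices (convex_hull A) v -> A v.
Proof. exact: vertices_face_hull (is_face_self _). Qed.

Lemma vertices_sub P F v :
  (forall x, F x -> P x) -> F v -> vertices P v -> vertices F v.
Proof.
move=> FP Fv /verticesP [c [b [Pv cv cb cu]]]; apply/verticesP; exists c, b.
by split=> // x /FP; [apply: cb|apply: cu].
Qed.

(** In a convex combination that maximizes the functional, every generator with a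
    nonzero coefficient is a maximizer too, hence equal to [v]. *)
Lemma vertex_hull A c b v :
  A v -> dotp c v = b -> (forall y, A y -> dotp c y <= b) ->
  (forall y, A y -> dotp c y = b -> y = v) -> vertices (convex_hull A) v.
Proof.
move=> Av cv cb uv; apply/verticesP; exists c, b.
split=> // [|x|x [m [p [a [Ap a0 a1 xe]]]] cx]; first exact: sub_convex_hull.
  exact: dotp_hull_le.
have pv i : a i != 0 -> p i = v.
  move=> ai; apply: uv => //; move: i ai.
  apply: (@wmean_max _ a (fun i => dotp c (p i))) => //; first by move=> *; apply: cb.
  by rewrite -dotp_sum -xe.
rewrite xe -[RHS]scale1r -a1 scaler_suml; apply: eq_bigr => i _.
by have [->|/pv->//] := eqVneq (a i) 0; rewrite !scale0r.
Qed.

End Hull.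

(** * The independence polytope *)

Section IndependencePolytope.
Context {R : realType} {E : finType} (M : matroid E).
Implicit Types (I J K : {set E}).

Lemma dotp_rho (c : 'rV[R]_#|E|) I :
  dotp c (rho R I) = weight (fun e => c 0 (enum_rank e)) I.
Proof.
rewrite /dotp /rho /weight; under eq_bigr => j _ do rewrite summxE big_distrr /=.
rewrite exchange_big /=; apply: eq_bigr => e _.
rewrite (bigD1 (enum_rank e)) //= mxE !eqxx mulr1 big1 ?addr0 // => j.
by rewrite mxE eqxx /= => /negPf->; rewrite mulr0.
Qed.

Lemma dotp_weight (f : E -> R) I :
  dotp (\row_j f (enum_val j)) (rho R I) = weight f I.
Proof. by rewrite dotp_rho; apply: eq_bigr => e _; rewrite mxE enum_rankK. Qed.

Lemma rho_inj : injective (@rho R E).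
Proof.
have rhoE I e : rho R I 0 (enum_rank e) = (e \in I)%:R.
  rewrite /rho summxE; have [eI|eI] := boolP (e \in I).
    rewrite (bigD1 e) //= mxE !eqxx big1 ?addr0 // => e' /andP[_].
    by rewrite mxE eqxx (inj_eq enum_rank_inj) eq_sym => /negPf->.
  rewrite big1 // => e' e'I; rewrite mxE eqxx (inj_eq enum_rank_inj) /=.
  by case: eqVneq e'I => // <-; rewrite (negPf eI).
move=> I J IJ; apply/setP => e; have := rhoE I e; rewrite IJ rhoE => /eqP.
by rewrite eqr_nat; case: (e \in I); case: (e \in J).
Qed.

Lemma independence_polytope_le c b x :
  {in indep M, forall K, dotp c (rho R K) <= b} ->
  independence_polytope R M x -> dotp c x <= b.
Proof. by move=> cb; apply: dotp_hull_le => _ [K KM <-]; apply: cb. Qed.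

Lemma rho_polytope I : I \in indep M -> independence_polytope R M (rho R I).
Proof. by move=> IM; apply: sub_convex_hull; exists I. Qed.

Lemma rho_vertex I :
  I \in indep M -> vertices (independence_polytope R M) (rho R I).
Proof.
move=> IM; have [f [b fb]] := @exposed1 R E M I.
apply: (@vertex_hull _ _ _ (\row_j f (enum_val j)) b).
- by exists I.
- by rewrite dotp_weight; apply/eqP; rewrite (fb I IM) /= eqxx.
- by move=> _ [K KM <-]; rewrite dotp_weight (fb K KM).
- move=> _ [K KM <-]; rewrite dotp_weight => /eqP.
  by rewrite (fb K KM) => /eqP->.
Qed.

(** A vertex of the polytope that lies on a segment joining two of its points is
    an endpoint, so the functional that cuts out the edge is maximized by [I] and
    [J] only among the independent sets. *)
Lemma sk_adj_adjacent I J :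
  I \in indep M -> J \in indep M ->
  sk_adj (independence_polytope R M) (rho R I) (rho R J) -> adjacent M I J.
Proof.
move=> IM JM [_ _ nIJ [[c [b [cb segE]]] _]].
set f := fun e => c 0 (enum_rank e).
apply: (@edge_adjacent _ _ _ f b) => //; last by apply/eqP => IJ; rewrite IJ in nIJ.
move=> K KM; rewrite -dotp_rho.
split; first exact/cb/rho_polytope.
have segP x : convex_hull [set rho R I; rho R J]%classic x ->
    independence_polytope R M x.
  by apply: convex_hull_mono => _ [->|->]; [exists I|exists J].
apply/eqP/idP => [cK|KIJ]; last first.
  suff : convex_hull [set rho R I; rho R J]%classic (rho R K) by rewrite segE => -[].
  by apply: sub_convex_hull; case/orP: KIJ => /eqP ->; [left|right].
have Kseg : convex_hull [set rho R I; rho R J]%classic (rho R K).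
  by rewrite segE; split=> //; apply: rho_polytope.
have := vertices_hull (vertices_sub segP Kseg (rho_vertex KM)).
by case=> /rho_inj ->; rewrite /= eqxx ?orbT.
Qed.

Lemma face_of_exposed (C : {set {set E}}) :
  C \subset indep M -> @exposed R E M (mem C) ->
  exists2 F, is_face (independence_polytope R M) F
           & vertices F = [set rho R I | I in [set I | I \in C]]%classic.
Proof.
move=> CM [f [b fb]]; pose c : 'rV[R]_#|E| := \row_j f (enum_val j).
pose P := independence_polytope R M.
pose F : set 'rV[R]_#|E| := [set x | P x /\ dotp c x = b]%classic.
have faceF : is_face P F.
  exists c, b; split=> // x; apply: independence_polytope_le => K KM.
  by rewrite dotp_weight (fb K KM).
exists F => //; apply/funext => v; apply/propext; split=> [vF|[I IC <-]].
  have [I IM vE] := vertices_face_hull faceF vF; exists I => //=.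
  have : F v by have /verticesP [d [b' []]] := vF.
  rewrite -vE => -[_]; rewrite dotp_weight => /eqP.
  by rewrite (fb I IM).
have IM := subsetP CM _ IC.
apply: (@vertices_sub _ _ P) => [x []//||]; last exact: rho_vertex.
split; first exact: rho_polytope.
by rewrite dotp_weight; apply/eqP; rewrite (fb I IM).
Qed.

End IndependencePolytope.

Theorem theorem4p8 (R : realType) (E : finType) (M : matroid E) :
  clique_face_property (independence_polytope R M).
Proof.
move=> C [vC adjC].
pose D := [set I in indep M | `[< C (rho R I) >]].
have DM : D \subset indep M by apply/subsetP => I; rewrite inE => /andP[].
have exD : @exposed R E M (mem D).
  apply: exposed_clique => // I J.
  rewrite !inE => /andP[IM /asboolP IC] /andP[JM /asboolP JC].
  have [<-|nIJ] := eqVneq I J; first by rewrite /adjacent setDv cards0 subxx.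
  apply: (@sk_adj_adjacent R) => //; apply: adjC => //.
  by move/rho_inj/eqP; apply/negP.
have [F faceF vF] := face_of_exposed DM exD.
exists F => //; rewrite vF; apply/funext => v; apply/propext; split.
  by move=> [I]; rewrite /= inE => /andP[_ /asboolP IC] <-.
move=> Cv; have [I IM vE] := vertices_hull (vC _ Cv).
by exists I => //=; rewrite inE IM; apply/asboolP; rewrite vE.
Qed.
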